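(* In the setting described in the context, there is an algorithm that, given the sorted training set, the validation point, $K$ and the discretized weights, computes the exact Shapley values $\phi_{z_i}$ of all $z_i\in D$ (with respect to the utility $v$) with total running time $O(WK^2N^2)$.
   Context: Training set $D=\{z_1,\dots,z_N\}$, $z_i=(x_i,y_i)$ with binary labels, validation point $z^{(\mathrm{val})}=(x^{(\mathrm{val})},y^{(\mathrm{val})})$, points indexed so that $d(x_1,x^{(\mathrm{val})})\le\cdots\le d(x_N,x^{(\mathrm{val})})$. Integer $K\ge2$. Each weight $w_j$ lies in the discretized set $\mathbf W\subset[0,1]$ consisting of $2^b$ equally spaced points of $[0,1]$ ($b$ bits), and $W:=|\mathbf W|=2^b$. Signed weights $\widetilde w_j=w_j$ if $y_j=y^{(\mathrm{val})}$, $-w_j$ otherwise. For $S\subseteq D$, $\alpha(S,j)$ is the $j$-th smallest index of a point in $S$, and $v(S)=\mathbb{1}[\sum_{j=1}^{\min(K,|S|)}\widetilde w_{\alpha(S,j)}\ge0]$. The Shapley value is $\phi_z=\frac1N\sum_{k=1}^N\binom{N-1}{k-1}^{-1}\sum_{S\subseteq D\setminus\{z\},|S|=k-1}[v(S\cup\{z\})-v(S)]$. *)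

(* Defs.v *)
From HB Require Import structures.
From mathcomp Require Import all_boot all_order all_algebra.

Set Implicit Arguments.
Unset Strict Implicit.
Unset Printing Implicit Defensive.

Import Order.TTheory GRing.Theory Num.Theory.

Local Open Scope ring_scope.

(** * Weighted nearest-neighbour Shapley values

    The training set is a family z : 'I_N -> X * bool of (features, label)
    pairs, and subsets of the training set are sets of indices {set 'I_N}.
    Indices start at 0. *)

(* 2^b equally spaced points of [0, 1], both end points included (b > 0). *)
Definition weight_grid (b : nat) : seq rat :=
  [seq j%:R / (2 ^ b - 1)%:R | j <- iota 0 (2 ^ b)].

Lemma size_weight_grid b : size (weight_grid b) = (2 ^ b)%N.
Proof. by rewrite size_map size_iota. Qed.

Lemma weight_grid_uniq b : (0 < b)%N -> uniq (weight_grid b).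
Proof.
move=> b_gt0; rewrite map_inj_uniq ?iota_uniq // => i j.
have nz : (2 ^ b - 1)%:R != 0 :> rat.
  by rewrite pnatr_eq0 subn_eq0 -ltnNge -{1}(expn0 2) ltn_exp2l.
by move/(divIf nz)/eqP; rewrite eqr_nat => /eqP.
Qed.

Section Shapley.

Variables (X : Type) (N K : nat).
Variables (z : 'I_N -> X * bool) (zval : X * bool) (w : 'I_N -> rat).

Definition signed_weight (j : 'I_N) : rat :=
  if (z j).2 == zval.2 then w j else - w j.

(* The j-th smallest index in S; enum S lists S in increasing order. *)
Definition alpha (S : {set 'I_N}) (j : 'I_#|S|) : 'I_N := enum_val j.

Definition utility (S : {set 'I_N}) : rat :=
  (0 <= \sum_(j < minn K #|S|)
          signed_weight (alpha (widen_ord (geq_minr K #|S|) j)))%R%:R.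

Definition shapley (i : 'I_N) : rat :=
  N%:R^-1 *
  \sum_(1 <= k < N.+1)
     'C(N.-1, k.-1)%:R^-1 *
     \sum_(S : {set 'I_N} | (S \subset [set~ i]) && (#|S| == k.-1))
        (utility (i |: S) - utility S).

End Shapley.

Lemma alpha_lt N (S : {set 'I_N}) (j k : 'I_#|S|) :
  (j < k)%N -> (alpha j < alpha k)%N.
Proof.
move=> ltjk; have x0 := enum_default j.
rewrite /alpha !(enum_val_nth x0).
have srt : sorted (fun a b : 'I_N => (a < b)%N) (enum S).
  rewrite {1}/enum_mem -enumT; apply: sorted_filter.
    by move=> ? ? ?; apply: ltn_trans.
  by have := iota_ltn_sorted 0 N; rewrite -val_enum_ord sorted_map.
apply: (sorted_ltn_nth _ _ srt) => //; first by move=> ? ? ?; apply: ltn_trans.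
  by rewrite inE -cardE.
by rewrite inE -cardE.
Qed.

(** * Computation model

    A two-sorted random access machine with unit-cost operations, programmed
    in a structured language.  Memory consists of arrays of naturals, which
    serve as loop counters, addresses and labels, and arrays of rationals,
    which carry numerical data.  A scalar variable is cell 0 of an array.

    As in the real RAM, exact arithmetic and comparison on rationals have unit
    cost, and there is no floor nor any other conversion from rationals to
    naturals.  Naturals only support addition, truncated subtraction and
    comparison, so that addresses grow at most exponentially with time.
    Dividing by 0 gives 0. *)

Inductive iexp : Type :=
| INum of nat
| IGet of nat & iexp            (* array name, address *)
| IAdd of iexp & iexp
| ISub of iexp & iexp.

Inductive vexp : Type :=
| VOfI of iexp
| VGet of nat & iexp
| VAdd of vexp & vexp
| VSub of vexp & vexp
| VMul of vexp & vexp
| VDiv of vexp & vexp.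

Inductive bexp : Type :=
| ILe of iexp & iexp
| VLe of vexp & vexp
| BNot of bexp
| BAnd of bexp & bexp.

Inductive cmd : Type :=
| Skip
| ISet of nat & iexp & iexp     (* array name, address, new contents *)
| VSet of nat & iexp & vexp
| Seq of cmd & cmd
| If of bexp & cmd & cmd
| While of bexp & cmd.

Record state : Type := State {
  imem : nat -> nat -> nat;     (* array name, address *)
  vmem : nat -> nat -> rat
}.

Definition upd (T : Type) (m : nat -> nat -> T) (a k : nat) (x : T) :=
  fun a' k' => if (a' == a) && (k' == k) then x else m a' k'.

Fixpoint ieval (s : state) (e : iexp) : nat :=
  match e with
  | INum n => n
  | IGet a e1 => imem s a (ieval s e1)
  | IAdd e1 e2 => ieval s e1 + ieval s e2
  | ISub e1 e2 => ieval s e1 - ieval s e2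
  end%N.

Fixpoint icost (e : iexp) : nat :=
  match e with
  | INum _ => 1
  | IGet _ e1 => (icost e1).+1
  | IAdd e1 e2 | ISub e1 e2 => (icost e1 + icost e2).+1
  end%N.

Fixpoint veval (s : state) (e : vexp) : rat :=
  match e with
  | VOfI e1 => (ieval s e1)%:R
  | VGet a e1 => vmem s a (ieval s e1)
  | VAdd e1 e2 => veval s e1 + veval s e2
  | VSub e1 e2 => veval s e1 - veval s e2
  | VMul e1 e2 => veval s e1 * veval s e2
  | VDiv e1 e2 => veval s e1 / veval s e2
  end.

Fixpoint vcost (e : vexp) : nat :=
  match e with
  | VOfI e1 | VGet _ e1 => (icost e1).+1
  | VAdd e1 e2 | VSub e1 e2 | VMul e1 e2 | VDiv e1 e2 =>
      (vcost e1 + vcost e2).+1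
  end%N.

Fixpoint beval (s : state) (e : bexp) : bool :=
  match e with
  | ILe e1 e2 => (ieval s e1 <= ieval s e2)%N
  | VLe e1 e2 => veval s e1 <= veval s e2
  | BNot e1 => ~~ beval s e1
  | BAnd e1 e2 => beval s e1 && beval s e2
  end.

Fixpoint bcost (e : bexp) : nat :=
  match e with
  | ILe e1 e2 => (icost e1 + icost e2).+1
  | VLe e1 e2 => (vcost e1 + vcost e2).+1
  | BNot e1 => (bcost e1).+1
  | BAnd e1 e2 => (bcost e1 + bcost e2).+1
  end%N.

(* exec c s t s' : started in s, the program c halts in s' after t steps. *)
Inductive exec : cmd -> state -> nat -> state -> Prop :=
| ExecSkip s : exec Skip s 1 s
| ExecISet s a e1 e2 :
    exec (ISet a e1 e2) s (icost e1 + icost e2).+1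
         (State (upd (imem s) a (ieval s e1) (ieval s e2)) (vmem s))
| ExecVSet s a e1 e2 :
    exec (VSet a e1 e2) s (icost e1 + vcost e2).+1
         (State (imem s) (upd (vmem s) a (ieval s e1) (veval s e2)))
| ExecSeq s1 s2 s3 t1 t2 c1 c2 :
    exec c1 s1 t1 s2 -> exec c2 s2 t2 s3 ->
    exec (Seq c1 c2) s1 (t1 + t2) s3
| ExecIf s s' t e c1 c2 :
    exec (if beval s e then c1 else c2) s t s' ->
    exec (If e c1 c2) s (bcost e + t).+1 s'
| ExecWhileF s e c :
    ~~ beval s e -> exec (While e c) s (bcost e).+1 s
| ExecWhileT s1 s2 s3 t1 t2 e c :
    beval s1 e -> exec c s1 t1 s2 -> exec (While e c) s2 t2 s3 ->
    exec (While e c) s1 (bcost e + t1 + t2).+1 s3.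

Lemma exec_det c s t1 s1 t2 s2 :
  exec c s t1 s1 -> exec c s t2 s2 -> t1 = t2 /\ s1 = s2.
Proof.
move=> E1; elim: E1 t2 s2 => {c s t1 s1}.
- by move=> s t2 s2 E2; inversion E2.
- by move=> s a e1 e2 t2 s2 E2; inversion E2.
- by move=> s a e1 e2 t2 s2 E2; inversion E2.
- move=> s1 s2 s3 t1 t2 c1 c2 _ IH1 _ IH2 u s' E2.
  inversion E2 as [| | |? m ? u1 u2 ? ? F1 F2| | |]; subst.
  by case: (IH1 _ _ F1) => -> e; subst; case: (IH2 _ _ F2) => -> ->.
- move=> s s' t e c1 c2 _ IH u s2 E2.
  inversion E2 as [| | | |? ? ? ? ? ? F| |]; subst.
  by case: (IH _ _ F) => -> ->.
- move=> s e c /negP nb u s2 E2.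
  by inversion E2 as [| | | | |? ? ? F|? ? ? ? ? ? ? F]; subst.
- move=> s1 s2 s3 t1 t2 e c b1 _ IH1 _ IH2 u s' E2.
  inversion E2 as [| | | | |? ? ? F|? m ? u1 u2 ? ? F F1 F2]; subst.
    by rewrite b1 in F.
  by case: (IH1 _ _ F1) => -> e'; subst; case: (IH2 _ _ F2) => -> ->.
Qed.

(** * Input and output conventions *)

Definition array_of (T : Type) (x0 : T) (N : nat) (f : 'I_N -> T) : nat -> T :=
  fun k => if insub k is Some i then f i else x0.

(* Natural arrays 0, 1, 2, 3 hold the scalars N, K, b and the validation
   label, natural array 4 the training labels; rational array 0 holds the
   weights.  All other memory is 0.  The features occur only through the
   order of the training points, so they are not part of the encoding. *)
Definition input_state (X : Type) (N K b : nat) (z : 'I_N -> X * bool)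
    (zval : X * bool) (w : 'I_N -> rat) : state :=
  State
    (fun a k =>
       match a, k with
       | 0, 0 => N
       | 1, 0 => K
       | 2, 0 => b
       | 3, 0 => zval.2
       | 4, _ => array_of 0 (fun i => (z i).2 : nat) k
       | _, _ => 0
       end%N)
    (fun a k => if a == 0 then array_of 0 w k else 0).

(* The i-th result is read in cell i of rational array 1. *)
Definition output (s : state) (i : nat) : rat := vmem s 1 i.

(* Main.v *)
Require Import Defs.
From HB Require Import structures.
From mathcomp Require Import all_boot all_order all_algebra.
From mathcomp Require Import zify ring.

(** Fix a player [i].  The Shapley weight of a coalition satisfies
    [g (M+1) k + g (M+1) (k+1) = g M k], so the points behind the [K]-th point of
    a coalition can be summed out: a coalition with at least [K] points matters
    only through its [K]-th point [p > i] and the [K-1] points before it, and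
    adding [i] replaces [p] by [i] in the vote.  Hence the Shapley value is
    determined by the number of sets of fewer than [K] points among the first
    [p], for each size and each sum of weights.

    Give the point [j] the integer key [B + (W-1) (1 + w~_j)] with [B = 2 K W].
    Size and weight sum of a set of at most [K] points are then read off its
    total key, and the counts form a single 0/1 knapsack table with
    [K B = 2 K^2 W] entries.  Adding a point costs one pass over this table,
    whence [O(W K^2 N)] per player. *)

Set Implicit Arguments.
Unset Strict Implicit.
Unset Printing Implicit Defensive.

Import Order.TTheory GRing.Theory Num.Theory.

Local Open Scope ring_scope.

(** * Subsets and enumerations of index sets, and Shapley weights *)

Lemma big_powersetU1 (T : finType) (V : nmodType) (x : T) (A : {set T})
    (f : {set T} -> V) :
  x \notin A ->
  \sum_(S in powerset (x |: A)) f S =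
  \sum_(S in powerset A) (f S + f (x |: S)).
Proof.
move=> xA; rewrite (bigID (fun S : {set T} => x \in S)) /= addrC big_split /=.
congr (_ + _).
  apply: eq_bigl => S; rewrite !powersetE.
  apply/andP/idP => [[SA xS]|SA].
    apply/subsetP => y yS; have := subsetP SA y yS; rewrite !inE.
    by case: eqP yS xS => // -> ->.
  split; first by apply: subset_trans SA (subsetUr _ _).
  by apply: contra xA; apply: (subsetP SA).
rewrite (reindex_onto (fun S : {set T} => x |: S) (fun S => S :\ x)) /=; last first.
  by move=> S /andP[_ xS]; rewrite setD1K.
apply: eq_bigl => S; rewrite !powersetE setU11 andbT.
apply/andP/idP => [[SA /eqP <-]|SA].
  by rewrite subDset.
split; first by rewrite setUS.
apply/eqP; rewrite setU1K //; by apply: contra xA; apply: (subsetP SA).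
Qed.

Lemma card_ord_lt N p : (#|[set j : 'I_N | (j < p)%N]| <= p)%N.
Proof.
case: (leqP N p) => [Np|/ltnW pN].
  by apply: leq_trans (max_card _) _; rewrite card_ord.
have -> : [set j : 'I_N | (j < p)%N] = widen_ord pN @: 'I_p.
  apply/setP => j; rewrite inE; apply/idP/imsetP => [jp|[k _ ->]] //=.
  by exists (Ordinal jp) => //; apply: val_inj.
by apply: leq_trans (leq_imset_card _ _) _; rewrite card_ord.
Qed.

(** Both lists are strictly increasing with the same members. A late point is thus appended at the
    end, out of reach of a vote that already has [K] points. *)
Lemma enum_setU1_max N (x : 'I_N) (S : {set 'I_N}) :
  (forall j, j \in S -> (j < x)%N) -> enum (x |: S) = rcons (enum S) x.
Proof.
move=> ltx.
have srt (A : {set 'I_N}) : sorted (fun a b : 'I_N => (a < b)%N) (enum A).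
  rewrite {1}/enum_mem -enumT; apply: sorted_filter.
    by move=> ? ? ?; apply: ltn_trans.
  by have := iota_ltn_sorted 0 N; rewrite -val_enum_ord sorted_map.
apply: (@irr_sorted_eq _ (fun a b : 'I_N => (a < b)%N)) => //.
- by move=> ? ? ?; apply: ltn_trans.
- by move=> ?; rewrite ltnn.
- rewrite -cats1 sorted_pairwise; last by move=> ? ? ?; apply: ltn_trans.
  rewrite pairwise_cat /= andbT -sorted_pairwise; last by move=> ? ? ?; apply: ltn_trans.
  rewrite srt andbT; apply/allrelP => a y; rewrite mem_enum inE => aS /eqP ->.
  exact: ltx.
- by move=> j; rewrite mem_enum mem_rcons !inE mem_enum.
Qed.

(* [k! (M - 1 - k)! / M!], the weight of a coalition of size [k] among the
   other [M - 1] players. *)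
Definition coalition_weight (M k : nat) : rat :=
  (k`!)%:R * ((M.-1 - k)`!)%:R / (M`!)%:R.

(** A further player either stays out of the coalition or joins it. With [M = k + m + 1] the
    identity is k! (m+1)! + (k+1)! m! = k! m! (k+m+2), divided by (k+m+2)!. *)
Lemma coalition_weightD M k : (k < M)%N ->
  coalition_weight M.+1 k + coalition_weight M.+1 k.+1 = coalition_weight M k.
Proof.
move=> kM; rewrite /coalition_weight /=.
have [m ->] : exists m, M = (k + m).+1 by exists (M - k.+1)%N; lia.
have -> : ((k + m).+1 - k = m.+1)%N by lia.
have -> : ((k + m).+1 - k.+1 = m)%N by lia.
have -> : ((k + m).+1.-1 - k = m)%N by lia.
rewrite !factS !natrM -!natr1 natrD.
have h1 : (((k + m)`!)%:R != 0 :> rat) by rewrite pnatr_eq0 -lt0n fact_gt0.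
have h2 : (k%:R + m%:R + 1 != 0 :> rat) by rewrite -natrD natr1 pnatr_eq0.
have h3 : (k%:R + m%:R + 1 + 1 != 0 :> rat) by rewrite -natrD !natr1 pnatr_eq0.
field; rewrite h1 /=; apply/andP; split=> //.
Qed.

Lemma coalition_weight_bin M k : (k < M)%N ->
  coalition_weight M k = M%:R^-1 * 'C(M.-1, k)%:R^-1.
Proof.
case: M => // M kM; rewrite /coalition_weight /= -invfM -natrM.
have := bin_fact (kM : (k <= M)%N) => e.
have nz n : ((n`!)%:R != 0 :> rat) by rewrite pnatr_eq0 -lt0n fact_gt0.
have nzC : ('C(M, k)%:R != 0 :> rat) by rewrite pnatr_eq0 -lt0n bin_gt0.
have nzM : (1 + M%:R != 0 :> rat) by rewrite nat1r pnatr_eq0.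
by rewrite factS -e !natrM -nat1r; field; rewrite !nz nzC nzM.
Qed.

(** * Shapley values as knapsack sums *)

(* Subset sums are encoded by keys: a set of [l <= K] points with keys in
   [B, B + 2 D] has total key [a] with [a %/ B = l], and its signed weight is
   nonnegative iff [l * (B + D) <= a]. *)
Definition key_vote (B D a : nat) : rat := (a %/ B * (B + D) <= a)%N%:R.

(** The counting recurrence of the 0/1 knapsack problem with item [i] left out. The counts are
    rationals, ready to be multiplied by votes and weights. *)
Fixpoint knapsack (c : nat -> nat) (i p a : nat) : rat :=
  if p is p'.+1 then
    knapsack c i p' a +
    (if (p' != i) && (c p' <= a)%N then knapsack c i p' (a - c p')%N else 0)
  else (a == 0)%N%:R.

(** For [a < K * B] the test on [a %/ B] selects exactly [K - 1] points, all before [p]. Then [p] is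
    the [K]-th point, and [i] pushes it out of the vote. The last factor is the total weight over
    all choices of points behind [p]. *)
Definition tail_term (c : nat -> nat) (K B D i p a : nat) : rat :=
  if (K.-1 <= a %/ B)%N then
    knapsack c i p a
    * (key_vote B D (a + c i)%N - key_vote B D (a + c p)%N)
    * coalition_weight p.+1 K
  else 0.

Definition tail_sum (c : nat -> nat) (K B D i n : nat) : rat :=
  \sum_(0 <= p < n)
    if (i < p)%N then \sum_(0 <= a < K * B) tail_term c K B D i p a else 0.

(** With fewer than [K] points nobody leaves the vote when [i] joins, so both votes are read off
    total keys. *)
Definition small_term (c : nat -> nat) (N B D i a : nat) : rat :=
  knapsack c i N a
  * (key_vote B D (a + c i)%N - key_vote B D a)
  * coalition_weight N (a %/ B).

Definition dp_value (c : nat -> nat) (N K B D i : nat) : rat :=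
  tail_sum c K B D i N + \sum_(0 <= a < K * B) small_term c N B D i a.

Section DynamicProgram.

Variables (X : Type) (N K : nat).
Variables (z : 'I_N -> X * bool) (zval : X * bool) (w : 'I_N -> rat).
Variables (c : nat -> nat) (B D : nat).
Hypothesis K_gt0 : (0 < K)%N.
Hypothesis D_gt0 : (0 < D)%N.
Hypothesis B_gt : (2 * D * K < B)%N.
Hypothesis c_bounds : forall j : 'I_N, (B <= c j <= B + 2 * D)%N.
Hypothesis c_signed : forall j : 'I_N,
  signed_weight z zval w j = ((c j)%:R - (B + D)%:R) / D%:R.

Local Notation u := (utility K z zval w).

Definition key (S : {set 'I_N}) : nat := (\sum_(j in S) c j)%N.

Lemma utility_take (x0 : 'I_N) (S : {set 'I_N}) :
  u S = (0 <= \sum_(j <- take K (enum S)) signed_weight z zval w j)%R%:R.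
Proof.
rewrite /utility; congr (_ <= _)%R%:R.
rewrite (big_nth x0) size_take_min -cardE big_mkord; apply: eq_bigr => j _.
rewrite /alpha (enum_val_nth x0) /= nth_take //.
by apply: leq_trans (ltn_ord j) (geq_minl _ _).
Qed.

Lemma utility_setU1_max (x : 'I_N) (S : {set 'I_N}) :
  (K <= #|S|)%N -> (forall j, j \in S -> (j < x)%N) -> u (x |: S) = u S.
Proof.
move=> KS ltx; rewrite !(utility_take x) (enum_setU1_max ltx) -cats1.
by rewrite takel_cat // -cardE.
Qed.

Lemma key_bounds (S : {set 'I_N}) :
  (#|S| * B <= key S <= #|S| * (B + 2 * D))%N.
Proof.
rewrite /key -!sum_nat_const; apply/andP; split; apply: leq_sum => j _;
by have /andP[] := c_bounds j.
Qed.

Lemma key_setU1 (x : 'I_N) (S : {set 'I_N}) :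
  x \notin S -> key (x |: S) = (key S + c x)%N.
Proof. by move=> xS; rewrite /key big_setU1 // addnC. Qed.

(** Each key exceeds [B] by at most [2 * D], so by [B_gt] the excesses of at most [K] keys add up to
    less than [B]. *)
Lemma key_div (S : {set 'I_N}) : (#|S| <= K)%N -> (key S %/ B = #|S|)%N.
Proof.
move=> SK; have /andP[lo hi] := key_bounds S.
have B_gt0 : (0 < B)%N by lia.
apply/eqP; rewrite eqn_leq leq_divRL // lo andbT -ltnS ltn_divLR //.
by apply: leq_ltn_trans hi _; nia.
Qed.

(** This fixes the table length: cutting the table at [K * B] keeps exactly the sets of fewer than
    [K] points. *)
Lemma key_lt (S : {set 'I_N}) : (key S < K * B)%N = (#|S| < K)%N.
Proof.
have /andP[lo hi] := key_bounds S.
have B_gt0 : (0 < B)%N by lia.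
case: (leqP K #|S|) => SK.
  by apply/negbTE; rewrite -leqNgt; apply: leq_trans lo; rewrite leq_mul2r SK orbT.
by apply: leq_ltn_trans hi _; nia.
Qed.

(** No point is cut off, and multiplying the signed sum by [D > 0] turns it into
    [key S - #|S| * (B + D)]. *)
Lemma utility_key (x0 : 'I_N) (S : {set 'I_N}) :
  (#|S| <= K)%N -> u S = key_vote B D (key S).
Proof.
move=> SK; rewrite (utility_take x0) take_oversize -?cardE //.
rewrite big_enum /= /key_vote key_div // (eq_bigr _ (fun j _ => c_signed j)).
rewrite -mulr_suml sumrB sumr_const -mulrnA -natr_sum.
by rewrite pmulr_lge0 ?invr_gt0 ?ltr0n // subr_ge0 ler_nat mulnC.
Qed.

(** * Coalitions within a prefix, and summing out the points behind it *)

Definition preceding (i : 'I_N) (p : nat) : {set 'I_N} :=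
  [set j : 'I_N | (j < p)%N && (j != i)].

Lemma precedingS_self (i : 'I_N) : preceding i i.+1 = preceding i i.
Proof.
apply/setP => j; rewrite !inE ltnS leq_eqVlt; case: (eqVneq j i) => [|ji] //=.
  by rewrite !andbF.
by rewrite (negbTE (ji : val j != val i)).
Qed.

Lemma precedingS (i x : 'I_N) : x != i ->
  preceding i x.+1 = x |: preceding i x.
Proof.
move=> xi; apply/setP => j; rewrite !inE ltnS leq_eqVlt.
rewrite (_ : (val j == val x) = (j == x)) //.
by case: (eqVneq j x) => [->|] //=.
Qed.

Lemma preceding_notin (i x : 'I_N) : x \notin preceding i x.
Proof. by rewrite !inE ltnn. Qed.

Lemma knapsack_count (i : 'I_N) p a : (p <= N)%N ->
  knapsack c i p a = \sum_(S in powerset (preceding i p)) (key S == a)%N%:R.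
Proof.
elim: p a => [|p IH] a pN /=.
  have -> : preceding i 0 = set0 by apply/setP => j; rewrite !inE.
  by rewrite powerset0 big_set1 /key big_set0 eq_sym.
have pN' := ltnW pN.
pose x := Ordinal pN; have px : p = val x by [].
rewrite IH //; case: (eqVneq p i) => [pi|pi] /=.
  by rewrite addr0 pi precedingS_self.
rewrite px precedingS // big_powersetU1 ?preceding_notin // big_split /=; congr (_ + _).
have keyU S : S \in powerset (preceding i x) -> key (x |: S) = (key S + c x)%N.
  rewrite powersetE => SP; apply: key_setU1.
  by apply: contra (preceding_notin i x); apply: (subsetP SP).
case: leqP => [ca|ca].
  rewrite IH //; apply: eq_bigr => S SP; rewrite keyU //; congr (nat_of_bool _)%:R.
  by rewrite -{2}(subnK ca) eqn_add2r.
(* A set containing [x] has key at least [c x > a], so none is counted. *)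
rewrite big1 // => S SP; rewrite keyU // gtn_eqF //.
by apply: leq_trans ca _; rewrite leq_addl.
Qed.

(** After exchanging the sums, each [S] meets only the address [a = key S], which is in range iff
    [#|S| < K]. *)
Lemma knapsack_sum (i : 'I_N) p (h : nat -> rat) : (p <= N)%N ->
  \sum_(0 <= a < K * B) knapsack c i p a * h a =
  \sum_(S in powerset (preceding i p)) if (#|S| < K)%N then h (key S) else 0.
Proof.
move=> pN; under eq_bigr => a _ do rewrite knapsack_count // mulr_suml.
rewrite exchange_big /=; apply: eq_bigr => S _; rewrite -key_lt.
rewrite big_mkord; case: ltnP => kS.
  rewrite (bigD1 (Ordinal kS)) //= eqxx mul1r big1 ?addr0 // => a.
  by rewrite -val_eqE /= eq_sym => /negbTE ->; rewrite mul0r.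
by rewrite big1 // => a _; rewrite gtn_eqF ?mul0r // (leq_trans (ltn_ord a)).
Qed.

Definition marginal (i : 'I_N) (S : {set 'I_N}) : rat := u (i |: S) - u S.

(** Strict, because [i] occupies one of the first [p] places without belonging to [S]. *)
Lemma card_preceding (i : 'I_N) p (S : {set 'I_N}) :
  (i < p)%N -> S \subset preceding i p -> (#|S| < p)%N.
Proof.
move=> ip SP; have iS : i \notin S.
  by apply/negP => /(subsetP SP); rewrite !inE eqxx andbF.
have <- : #|i |: S| = #|S|.+1 by rewrite cardsU1 iS.
apply: leq_trans (card_ord_lt N p); apply/subset_leq_card/subsetP => j.
rewrite !inE => /orP[/eqP -> //|/(subsetP SP)].
by rewrite !inE => /andP[].
Qed.

(** The weights are those of the game restricted to the first [p] points. Letting [p] grow from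
    [i + 1] to [N] reaches the full game one point at a time. *)
Definition large_sum (i : 'I_N) p : rat :=
  \sum_(S in powerset (preceding i p))
    if (K <= #|S|)%N then coalition_weight p #|S| * marginal i S else 0.

(* If [S] has at least [K] points before [p], adding [p] changes nothing and the
   two weights recombine by [coalition_weightD]; otherwise [p] must be the
   [K]-th point, which is displaced when [i] is added. *)
Lemma large_sumS (i x : 'I_N) : (i < x)%N ->
  large_sum i x.+1 =
  large_sum i x + \sum_(0 <= a < K * B) tail_term c K B D i x a.
Proof.
move=> ix; have xi : x != i by rewrite -val_eqE gtn_eqF.
rewrite /large_sum precedingS // big_powersetU1 ?preceding_notin //.
set T := \sum_(0 <= a < _) _.
have -> : T = \sum_(0 <= a < K * B) knapsack c i x a *
   (if (K.-1 <= a %/ B)%N then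
    (key_vote B D (a + c i)%N - key_vote B D (a + c x)%N)
    * coalition_weight x.+1 K else 0).
  by apply: eq_bigr => a _; rewrite /tail_term; case: ifP; rewrite ?mulr0 ?mulrA.
rewrite knapsack_sum ?(ltnW (ltn_ord x)) // -big_split /=.
apply: eq_bigr => S; rewrite powersetE => SP.
have ltx j : j \in S -> (j < x)%N.
  by move/(subsetP SP); rewrite !inE => /andP[].
have xS : x \notin S by apply/negP => /ltx; rewrite ltnn.
have iS : i \notin S by apply/negP => /(subsetP SP); rewrite !inE eqxx andbF.
have ltxi j : j \in i |: S -> (j < x)%N by rewrite !inE => /orP[/eqP -> //|/ltx].
have Sx := card_preceding ix SP.
have cxS : #|x |: S| = #|S|.+1 by rewrite cardsU1 xS.
have ciS : #|i |: S| = #|S|.+1 by rewrite cardsU1 iS.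
rewrite cxS.
(* Once [i |: S] has [K] points, the later point [x] no longer influences its vote. *)
have swap : (K <= #|S|.+1)%N ->
    marginal i (x |: S) = u (i |: S) - u (x |: S).
  by move=> KS; rewrite /marginal setUCA utility_setU1_max // ciS.
case: (ltngtP K #|S|.+1) => KS.
- have KS' : (K <= #|S|)%N by [].
  rewrite KS' addr0 swap ?(ltnW KS) // (utility_setU1_max KS' ltx).
  by rewrite -/(marginal i S) -mulrDl coalition_weightD.
- have SK : (#|S| < K)%N by lia.
  rewrite (leqNgt K) SK /= key_div ?(ltnW SK) // ifF; first by rewrite !addr0.
  by apply/negbTE; rewrite -ltnNge; lia.
- have SK : (#|S| < K)%N by lia.
  rewrite (leqNgt K) SK /= key_div ?(ltnW SK) // !add0r ifT; last by lia.
  have KS' : (K <= #|S|.+1)%N by rewrite -KS.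
  rewrite (swap KS') !(utility_key x) ?ciS ?cxS // !key_setU1 //.
  by rewrite -KS mulrC.
Qed.

(** Here [i] comes after at least [K] points of [S] and never votes. This is why [tail_sum] only
    collects [p > i]. *)
Lemma large_sum0 (i : 'I_N) : large_sum i i.+1 = 0.
Proof.
rewrite /large_sum precedingS_self big1 // => S; rewrite powersetE => SP.
case: ifP => // KS; rewrite /marginal utility_setU1_max ?subrr ?mulr0 //.
by move=> j /(subsetP SP); rewrite !inE => /andP[].
Qed.

Lemma large_sumE (i : 'I_N) p : (i < p <= N)%N ->
  large_sum i p = tail_sum c K B D i p.
Proof.
elim: p => // p IH /andP[ip pN]; rewrite /tail_sum big_nat_recr //=.
move: ip; rewrite ltnS leq_eqVlt => /orP[/eqP ip|ip].
  rewrite -ip large_sum0 ltnn addr0 big_nat big1 // => q /andP[_ qi].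
  by rewrite ltnNge (ltnW qi).
pose x := Ordinal pN; have px : p = val x by [].
by rewrite ip px large_sumS // IH ?ip ?(ltnW pN).
Qed.

Lemma shapley_coalitions (i : 'I_N) :
  shapley K z zval w i =
  \sum_(S in powerset (preceding i N)) coalition_weight N #|S| * marginal i S.
Proof.
have -> : preceding i N = [set~ i] by apply/setP => j; rewrite !inE ltn_ord.
rewrite /shapley big_add1 /= big_mkord.
under [X in _ * X]eq_bigr => k _ do rewrite mulr_sumr big_mkcondr /=.
rewrite exchange_big /= mulr_sumr; apply: eq_big => [S|S SP].
  by rewrite powersetE.
have SN : (#|S| < N)%N.
  apply: (@card_preceding i) => //; apply: (subset_trans SP).
  by apply/subsetP => j; rewrite !inE ltn_ord.
(* In the outer sum, shifted to start at 0, only the size of [S] itself contributes. *)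
rewrite (bigD1 (Ordinal SN)) //= eqxx big1 ?addr0; last first.
  by move=> k; rewrite -val_eqE eq_sym /= => /negbTE ->.
by rewrite coalition_weight_bin // mulrA.
Qed.

(** Coalitions split by size: those with at least [K] points form [large_sum i N], the others are
    grouped by key. *)
Lemma shapley_dp (i : 'I_N) : shapley K z zval w i = dp_value c N K B D i.
Proof.
rewrite shapley_coalitions /dp_value -large_sumE ?ltn_ord ?leqnn //.
under [X in _ = _ + X]eq_bigr => a _ do rewrite /small_term -mulrA.
rewrite knapsack_sum // -big_split /=; apply: eq_bigr => S.
rewrite powersetE => SP.
have iS : i \notin S by apply/negP => /(subsetP SP); rewrite !inE eqxx andbF.
case: ltnP => SK; last by rewrite addr0.
rewrite add0r key_div ?(ltnW SK) // mulrC /marginal.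
by rewrite !(utility_key i) ?(ltnW SK) ?cardsU1 ?iS // key_setU1.
Qed.

End DynamicProgram.

(** * Timed total correctness *)

Definition runs (c : cmd) (s : state) (T : nat) (Q : state -> Prop) : Prop :=
  exists t s', [/\ exec c s t s', (t <= T)%N & Q s'].

Lemma runs_weaken c s T T' (Q Q' : state -> Prop) :
  runs c s T Q -> (T <= T')%N -> (forall s', Q s' -> Q' s') -> runs c s T' Q'.
Proof.
move=> [t [s' [E tT Qs]]] TT' QQ'; exists t, s'; split=> //; last exact: QQ'.
exact: leq_trans TT'.
Qed.

Lemma runs_seq c1 c2 s T1 T2 Q :
  runs c1 s T1 (fun s' => runs c2 s' T2 Q) -> runs (Seq c1 c2) s (T1 + T2) Q.
Proof.
move=> [t1 [s1 [E1 l1 [t2 [s2 [E2 l2 Qs]]]]]].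
by exists (t1 + t2)%N, s2; split; [exact: ExecSeq E1 E2|exact: leq_add|].
Qed.

Lemma runs_if e c1 c2 s T Q :
  runs (if beval s e then c1 else c2) s T Q ->
  runs (If e c1 c2) s (bcost e + T).+1 Q.
Proof.
move=> [t [s' [E tT Qs]]]; exists (bcost e + t).+1, s'.
by split=> //; [exact: ExecIf|rewrite ltnS leq_add2l].
Qed.

Fixpoint loop_free (c : cmd) : bool :=
  match c with
  | Seq c1 c2 | If _ c1 c2 => loop_free c1 && loop_free c2
  | While _ _ => false
  | _ => true
  end.

Fixpoint run_loop_free (c : cmd) (s : state) : state :=
  match c with
  | ISet a e1 e2 => State (upd (imem s) a (ieval s e1) (ieval s e2)) (vmem s)
  | VSet a e1 e2 => State (imem s) (upd (vmem s) a (ieval s e1) (veval s e2))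
  | Seq c1 c2 => run_loop_free c2 (run_loop_free c1 s)
  | If e c1 c2 => if beval s e then run_loop_free c1 s else run_loop_free c2 s
  | _ => s
  end.

(** Adding the costs of both branches of an [If] bounds either one; only constants suffer. *)
Fixpoint max_cost (c : cmd) : nat :=
  match c with
  | Skip => 1
  | ISet _ e1 e2 => (icost e1 + icost e2).+1
  | VSet _ e1 e2 => (icost e1 + vcost e2).+1
  | Seq c1 c2 => max_cost c1 + max_cost c2
  | If e c1 c2 => (bcost e + (max_cost c1 + max_cost c2)).+1
  | While _ _ => 0
  end%N.

(** Loop-free code is verified by symbolic evaluation, with a time bound independent of the
    state. *)
Lemma runs_loop_free c s T (Q : state -> Prop) :
  loop_free c -> (max_cost c <= T)%N -> Q (run_loop_free c s) -> runs c s T Q.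
Proof.
move=> lf cT Qs.
suff [t [E tc]] : exists t, exec c s t (run_loop_free c s) /\ (t <= max_cost c)%N.
  by exists t, (run_loop_free c s); split=> //; apply: leq_trans cT.
elim: c s lf {T cT Qs} => //=.
- by move=> s _; exists 1%N; split=> //; constructor.
- by move=> a e1 e2 s _; eexists; split; first exact: ExecISet.
- by move=> a e1 e2 s _; eexists; split; first exact: ExecVSet.
- move=> c1 IH1 c2 IH2 s /andP[l1 l2].
  have [t1 [E1 le1]] := IH1 s l1; have [t2 [E2 le2]] := IH2 (run_loop_free c1 s) l2.
  by exists (t1 + t2)%N; split; [exact: ExecSeq E1 E2|exact: leq_add].
- move=> e c1 IH1 c2 IH2 s /andP[l1 l2].
  case be: (beval s e).
    have [t [E le]] := IH1 s l1; exists (bcost e + t).+1; split; last by lia.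
    by apply: ExecIf; rewrite be.
  have [t [E le]] := IH2 s l2; exists (bcost e + t).+1; split; last by lia.
  by apply: ExecIf; rewrite be.
Qed.

Definition cell (a : nat) : iexp := IGet a (INum 0).

Definition For (v : nat) (e : iexp) (c : cmd) : cmd :=
  Seq (ISet v (INum 0) (INum 0))
      (While (BNot (ILe e (cell v)))
             (Seq c (ISet v (INum 0) (IAdd (cell v) (INum 1))))).

Definition set_counter (v k : nat) (s : state) : state :=
  State (upd (imem s) v 0 k) (vmem s).

(** The bound [e] is re-evaluated at each test, so it must keep the value [n]. Initialization costs
    3, each of the [n + 1] tests [icost e + 5], and each increment 6. *)
Lemma runs_for v e c s n T (I : nat -> state -> Prop) :
  I 0 (set_counter v 0 s) ->
  (forall k s', (k <= n)%N -> I k s' -> imem s' v 0 = k /\ ieval s' e = n) ->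
  (forall k s', (k < n)%N -> I k s' ->
     runs c s' T (fun s'' => imem s'' v 0 = k /\ I k.+1 (set_counter v k.+1 s''))) ->
  runs (For v e c) s ((icost e + 11 + T) * n + icost e + 8) (I n).
Proof.
move=> I0 Iv Ic.
suff loop m k s' : (k + m = n)%N -> I k s' ->
    runs (While (BNot (ILe e (cell v)))
           (Seq c (ISet v (INum 0) (IAdd (cell v) (INum 1))))) s'
         ((icost e + 11 + T) * m + icost e + 5) (I n).
  apply: (@runs_weaken _ _ (3 + ((icost e + 11 + T) * n + icost e + 5)) _ (I n)) => //.
    by apply: runs_seq; apply: runs_loop_free => //; apply: (loop n 0%N); [|exact: I0].
  by lia.
elim: m k s' => [|m IH] k s' km Ik.
  rewrite addn0 in km; subst k; have [vk en] := Iv n s' (leqnn n) Ik.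
  eexists; exists s'; split; [apply: ExecWhileF| |exact: Ik].
    by rewrite /= negbK en vk.
  by rewrite /=; lia.
have kn : (k < n)%N by lia.
have [vk en] := Iv k s' (ltnW kn) Ik.
have [t [s1 [E1 tT [v1 I1]]]] := Ic k s' kn Ik.
have [|t' [s2 [E2 t'T I2]]] := IH k.+1 _ _ I1; first by lia.
eexists; exists s2; split; [apply: ExecWhileT| |exact: I2].
- by rewrite /= en vk -ltnNge.
- apply: ExecSeq E1 _; apply: ExecISet.
- by rewrite /= v1 addn1; apply: E2.
- by rewrite /=; lia.
Qed.

Lemma upd_same (T : Type) (m : nat -> nat -> T) a k x : upd m a k x a k = x.
Proof. by rewrite /upd !eqxx. Qed.

Lemma upd_addr (T : Type) (m : nat -> nat -> T) a k x k' :
  k' != k -> upd m a k x a k' = m a k'.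
Proof. by rewrite /upd => /negbTE ->; rewrite andbF. Qed.

Lemma upd_array (T : Type) (m : nat -> nat -> T) a k x a' k' :
  a' != a -> upd m a k x a' k' = m a' k'.
Proof. by rewrite /upd => /negbTE ->. Qed.

(** * A program for the Shapley values *)

(* [iA], [iI], [iP] are loop counters, [iC] holds the keys, [iQ] the quotients
   [a %/ B], [vV] the votes [key_vote B D a] and [vF] the knapsack table. *)

Local Notation iN := 0%N (only parsing).
Local Notation iK := 1%N (only parsing).
Local Notation ib := 2%N (only parsing).
Local Notation iy := 3%N (only parsing).
Local Notation ilab := 4%N (only parsing).
Local Notation iW := 5%N (only parsing).
Local Notation iB := 6%N (only parsing).
Local Notation iL := 7%N (only parsing).
Local Notation iI := 8%N (only parsing).
Local Notation iP := 9%N (only parsing).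
Local Notation iA := 10%N (only parsing).
Local Notation iC := 11%N (only parsing).
Local Notation iQ := 12%N (only parsing).
Local Notation vw := 0%N (only parsing).
Local Notation vout := 1%N (only parsing).
Local Notation vV := 2%N (only parsing).
Local Notation vfact := 3%N (only parsing).
Local Notation vF := 4%N (only parsing).

(** The machine cannot multiply naturals: [W] arises by doubling, then [B] and [L] by repeated
    addition. *)
Definition compute_W : cmd :=
  Seq (ISet iW (INum 0) (INum 1))
      (For iA (cell ib) (ISet iW (INum 0) (IAdd (cell iW) (cell iW)))).

Definition compute_B : cmd :=
  Seq (ISet iB (INum 0) (INum 0))
      (For iA (cell iK)
         (ISet iB (INum 0) (IAdd (cell iB) (IAdd (cell iW) (cell iW))))).

Definition compute_L : cmd :=
  Seq (ISet iL (INum 0) (INum 0))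
      (For iA (cell iK) (ISet iL (INum 0) (IAdd (cell iL) (cell iB)))).

Definition iD : iexp := ISub (cell iW) (INum 1).

(** Votes are looked up at [a + c j] with [a < L] and a key below [2 * B], hence the range.
    Quotients follow from [a %/ B = (a - B) %/ B + 1]; the product in the vote test is taken in the
    rationals. *)
Definition compute_votes : cmd :=
  For iA (IAdd (cell iL) (IAdd (cell iB) (cell iB)))
    (Seq (If (ILe (cell iB) (cell iA))
             (ISet iQ (cell iA)
                (IAdd (IGet iQ (ISub (cell iA) (cell iB))) (INum 1)))
             (ISet iQ (cell iA) (INum 0)))
         (If (VLe (VMul (VOfI (IGet iQ (cell iA))) (VOfI (IAdd (cell iB) iD)))
                  (VOfI (cell iA)))
             (VSet vV (cell iA) (VOfI (INum 1)))
             (VSet vV (cell iA) (VOfI (INum 0))))).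

(** The range goes beyond [N] because tail terms read the factorial of [K], and [K] may exceed
    [N]. *)
Definition compute_factorials : cmd :=
  Seq (VSet vfact (INum 0) (VOfI (INum 1)))
      (For iA (IAdd (cell iN) (cell iK))
         (VSet vfact (IAdd (cell iA) (INum 1))
            (VMul (VOfI (IAdd (cell iA) (INum 1))) (VGet vfact (cell iA))))).

(* There is no rounding instruction: the numerator of a weight is the last
   [a < W] with [a <= w * (W - 1)]. *)
Definition compute_keys : cmd :=
  For iP (cell iN)
    (Seq (For iA (cell iW)
            (If (VLe (VOfI (cell iA)) (VMul (VGet vw (cell iP)) (VOfI iD)))
                (ISet iC (cell iP) (cell iA))
                Skip))
         (If (BAnd (ILe (IGet ilab (cell iP)) (cell iy))
                   (ILe (cell iy) (IGet ilab (cell iP))))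
             (ISet iC (cell iP)
                (IAdd (IAdd (cell iB) iD) (IGet iC (cell iP))))
             (ISet iC (cell iP)
                (ISub (IAdd (cell iB) iD) (IGet iC (cell iP)))))).

Definition setup : cmd :=
  Seq compute_W (Seq compute_B (Seq compute_L
    (Seq compute_votes (Seq compute_factorials compute_keys)))).

Definition key_at (p : nat) : iexp := IGet iC (cell p).

(** [M1] stands for [M - 1]. *)
Definition weight_exp (M M1 k : iexp) : vexp :=
  VDiv (VMul (VGet vfact k) (VGet vfact (ISub M1 k))) (VGet vfact M).

Definition add_out (e : vexp) : cmd :=
  VSet vout (cell iI) (VAdd (VGet vout (cell iI)) e).

Definition tail_loop : cmd :=
  For iA (cell iL)
    (If (ILe (ISub (cell iK) (INum 1)) (IGet iQ (cell iA)))
        (add_out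
           (VMul
              (VMul (VGet vF (cell iA))
                 (VSub (VGet vV (IAdd (cell iA) (key_at iI)))
                       (VGet vV (IAdd (cell iA) (key_at iP)))))
              (weight_exp (IAdd (cell iP) (INum 1)) (cell iP) (cell iK))))
        Skip).

(* The table is updated in place, from the largest address down. *)
Definition knapsack_loop : cmd :=
  let a := ISub (ISub (cell iL) (INum 1)) (cell iA) in
  For iA (cell iL)
    (If (ILe (key_at iP) a)
        (VSet vF a (VAdd (VGet vF a) (VGet vF (ISub a (key_at iP)))))
        Skip).

(** Tail terms at [p] refer to the points before [p], so they are collected before [p] enters the
    table. *)
Definition point_step : cmd :=
  Seq (If (BNot (ILe (cell iP) (cell iI))) tail_loop Skip)
      (If (BNot (BAnd (ILe (cell iP) (cell iI)) (ILe (cell iI) (cell iP))))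
          knapsack_loop Skip).

Definition small_loop : cmd :=
  For iA (cell iL)
    (add_out
       (VMul
          (VMul (VGet vF (cell iA))
             (VSub (VGet vV (IAdd (cell iA) (key_at iI)))
                   (VGet vV (cell iA))))
          (weight_exp (cell iN) (ISub (cell iN) (INum 1))
             (IGet iQ (cell iA))))).

Definition player_step : cmd :=
  Seq (For iA (cell iL) (VSet vF (cell iA) (VOfI (INum 0))))
  (Seq (Seq (VSet vF (INum 0) (VOfI (INum 1)))
            (VSet vout (cell iI) (VOfI (INum 0))))
  (Seq (For iP (cell iN) point_step) small_loop)).

Definition shapley_program : cmd := Seq setup (For iI (cell iN) player_step).

(** * Memory invariants and the set-up phase *)

Section Correctness.

Variables (N K b yv : nat) (lab xs : nat -> nat) (ww : nat -> rat).
Let W := (2 ^ b)%N.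
Let D := (W - 1)%N.
Let B := (K * (W + W))%N.
Let L := (K * B)%N.
Hypothesis N_gt0 : (0 < N)%N.
Hypothesis K_gt0 : (0 < K)%N.
Hypothesis b_gt0 : (0 < b)%N.
Hypothesis xsP : forall j, (j < N)%N -> ww j = (xs j)%:R / D%:R /\ (xs j < W)%N.

(** [xs j] is the numerator of the weight over [D]. As [xs j <= D], the truncated subtraction is
    exact. *)
Definition encoded_key (j : nat) : nat :=
  if lab j == yv then (B + D + xs j)%N else (B + D - xs j)%N.

Local Notation c := encoded_key.

Definition has_input (s : state) : Prop :=
  [/\ imem s iN 0 = N, imem s iK 0 = K, imem s ib 0 = b & imem s iy 0 = yv]
  /\ (forall j, (j < N)%N -> imem s ilab j = lab j /\ vmem s vw j = ww j).

Definition has_sizes (s : state) : Prop :=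
  [/\ has_input s, imem s iW 0 = W, imem s iB 0 = B & imem s iL 0 = L].

Definition has_votes (n : nat) (s : state) : Prop :=
  forall a, (a < n)%N -> imem s iQ a = (a %/ B)%N /\ vmem s vV a = key_vote B D a.

Definition has_factorials (n : nat) (s : state) : Prop :=
  forall k, (k < n)%N -> vmem s vfact k = (k`!)%:R.

Definition has_keys (n : nat) (s : state) : Prop :=
  forall j, (j < n)%N -> imem s iC j = c j.

Definition ready (s : state) : Prop :=
  [/\ has_sizes s, has_votes (L + (B + B)) s, has_factorials (N + K).+1 s
    & has_keys N s].

Lemma W_gt1 : (1 < W)%N.
Proof. by rewrite /W -{1}(expn0 2) ltn_exp2l. Qed.

Lemma B_gt0 : (0 < B)%N.
Proof. by have := W_gt1; rewrite /B; nia. Qed.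

Lemma L_gt0 : (0 < L)%N.
Proof. by have := B_gt0; rewrite /L; nia. Qed.

Lemma runs_compute_W s : has_input s ->
  runs compute_W s (30 * b + 30) (fun s' => has_input s' /\ imem s' iW 0 = W).
Proof.
move=> H.
pose I k s' := [/\ has_input s', imem s' iA 0 = k & imem s' iW 0 = (2 ^ k)%N].
apply: (@runs_weaken _ _ (3 + ((2 + 11 + 10) * b + 2 + 8)) _ (I b)).
- apply: runs_seq; apply: runs_loop_free => //; apply: runs_for => //.
  + by move=> k s' _ [[[_ _ e _] _] ? _].
  + move=> k s' _ [H' A' W']; apply: runs_loop_free => //; split; first exact: A'.
    split; [exact: H'|exact: upd_same|].
    by rewrite /= upd_array // upd_same W' expnS mul2n addnn.
- by lia.
- by move=> s' [].
Qed.

Lemma runs_compute_B s : has_input s -> imem s iW 0 = W ->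
  runs compute_B s (30 * K + 30)
    (fun s' => [/\ has_input s', imem s' iW 0 = W & imem s' iB 0 = B]).
Proof.
move=> H HW.
pose I k s' := [/\ has_input s', imem s' iW 0 = W, imem s' iA 0 = k
                 & imem s' iB 0 = (k * (W + W))%N].
apply: (@runs_weaken _ _ (3 + ((2 + 11 + 15) * K + 2 + 8)) _ (I K)).
- apply: runs_seq; apply: runs_loop_free => //; apply: runs_for => //.
  + by move=> k s' _ [[[_ e _ _] _] _ ? _].
  + move=> k s' _ [H' W' A' B']; apply: runs_loop_free => //; split; first exact: A'.
    split; [exact: H'|exact: W'|exact: upd_same|].
    by rewrite /= upd_array // upd_same W' B' mulSn addnC.
- by lia.
- by move=> s' [].
Qed.

Lemma runs_compute_L s :
  has_input s -> imem s iW 0 = W -> imem s iB 0 = B ->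
  runs compute_L s (30 * K + 30) has_sizes.
Proof.
move=> H HW HB.
pose I k s' := [/\ has_input s', imem s' iW 0 = W, imem s' iB 0 = B
                 & imem s' iA 0 = k /\ imem s' iL 0 = (k * B)%N].
apply: (@runs_weaken _ _ (3 + ((2 + 11 + 15) * K + 2 + 8)) _ (I K)).
- apply: runs_seq; apply: runs_loop_free => //; apply: runs_for => //.
  + by move=> k s' _ [[[_ e _ _] _] _ _ [? _]].
  + move=> k s' _ [H' W' B' [A' L']]; apply: runs_loop_free => //; split; first exact: A'.
    split; [exact: H'|exact: W'|exact: B'|split; first exact: upd_same].
    by rewrite /= upd_array // upd_same B' L' mulSn addnC.
- by lia.
- by move=> s' [? ? ? []].
Qed.

Lemma runs_compute_votes s : has_sizes s ->
  runs compute_votes s (300 * L)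
    (fun s' => has_sizes s' /\ has_votes (L + (B + B)) s').
Proof.
move=> H.
pose I k s' := [/\ has_sizes s', imem s' iA 0 = k & has_votes k s'].
apply: (@runs_weaken _ _ ((8 + 11 + (25 + 30)) * (L + (B + B)) + 8 + 8) _
                     (I (L + (B + B))%N)).
- apply: runs_for => //.
    by move=> k s' _ [[_ _ Bs Ls] ? _]; rewrite /= Bs Ls.
  move=> k s' _ [H' A' V']; have [_ W' B' _] := H'.
  apply: runs_seq; apply: runs_loop_free => //; set s1 := run_loop_free _ _.
  have : [/\ has_sizes s1, imem s1 iA 0 = k, has_votes k s1
           & imem s1 iQ k = (k %/ B)%N].
    rewrite /s1 /= A' B'; case: leqP => Bk; (split; [exact: H'|exact: A'| |]).
    + by move=> a ak; rewrite /= upd_addr ?ltn_eqF //; exact: V'.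
    (* As [B > 0], the quotient at [k - B] has already been stored. *)
    + rewrite /= upd_same (V' _ _).1; last by have := B_gt0; lia.
      by rewrite -{2}(subnK Bk) divnDr // divnn B_gt0.
    + by move=> a ak; rewrite /= upd_addr ?ltn_eqF //; exact: V'.
    + by rewrite /= upd_same divn_small.
  move: s1 => s1 {V'} [H1 A1 V1 Q1]; have [_ W1 B1 _] := H1.
  apply: runs_loop_free => //; set s2 := run_loop_free _ _.
  have Es2 : s2 = State (imem s1) (upd (vmem s1) vV k (key_vote B D k)).
    rewrite /s2 /= A1 Q1 B1 W1 -natrM ler_nat /key_vote -/D.
    by case: leqP.
  rewrite Es2; split; first exact: A1.
  split; [exact: H1|exact: upd_same|] => a; rewrite ltnS leq_eqVlt.
  case/orP => [/eqP ->|ak]; first by rewrite /= upd_same.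
  by rewrite /= upd_addr ?ltn_eqF //; exact: V1.
(* [B <= L] bounds the range [L + 2 * B] by [3 * L]. *)
- have := B_gt0; have : (B <= L)%N by rewrite /L leq_pmull.
  by move: L B => l b'; lia.
- by move=> s' [].
Qed.

Lemma runs_compute_factorials s :
  has_sizes s -> has_votes (L + (B + B)) s ->
  runs compute_factorials s (60 * (N + K) + 60)
    (fun s' => [/\ has_sizes s', has_votes (L + (B + B)) s'
                 & has_factorials (N + K).+1 s']).
Proof.
move=> H HV.
pose I k s' := [/\ has_sizes s', has_votes (L + (B + B)) s', imem s' iA 0 = k
                 & has_factorials k.+1 s'].
apply: (@runs_weaken _ _ (4 + ((5 + 11 + 30) * (N + K) + 5 + 8)) _ (I (N + K)%N)).
- apply: runs_seq; apply: runs_loop_free => //; apply: runs_for.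
  + by split=> // -[|[]] // _; rewrite /= upd_same.
  + by move=> k s' _ [[[[? ? _ _] _] _ _ _] _ ? _]; split=> //=; congr (_ + _)%N.
  move=> k s' _ [H' V' A' F']; apply: runs_loop_free => //.
  rewrite /= A' F' // addn1; split; first by [].
  split; [exact: H'|exact: V'|exact: upd_same|] => a; rewrite ltnS leq_eqVlt.
  case/orP => [/eqP ->|ak]; first by rewrite /= upd_same factS natrM.
  by rewrite /= upd_addr ?ltn_eqF //; exact: F'.
- by lia.
- by move=> s' [].
Qed.

Lemma runs_compute_keys s :
  has_sizes s -> has_votes (L + (B + B)) s -> has_factorials (N + K).+1 s ->
  runs compute_keys s (100 * (W * N) + 100) ready.
Proof.
move=> H HV HF.
pose J k s' := [/\ has_sizes s', has_votes (L + (B + B)) s',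
  has_factorials (N + K).+1 s', imem s' iP 0 = k & has_keys k s'].
have W1 := W_gt1.
apply: (@runs_weaken _ _ ((2 + 11 + (((2 + 11 + 24) * W + 2 + 8) + 50)) * N + 2 + 8) _
                     (J N)).
- apply: runs_for => //.
    by move=> k s' _ [[[[? _ _ _] _] _ _ _] _ _ ? _].
  move=> k s' kN [H' V' F' P' C']; apply: runs_seq.
  have [wk xk] := xsP kN.
  (* Scanning candidates upwards leaves the last one not above [xs k], so [a = W] yields [xs k].
     Before the first pass the cell is arbitrary, hence the guard. *)
  pose I a s1 := [/\ J k s1, imem s1 iA 0 = a
    & (0 < a)%N -> imem s1 iC k = minn (xs k) a.-1].
  apply: (@runs_weaken _ _ ((2 + 11 + 24) * W + 2 + 8) _ (I W)) => //.
    apply: runs_for => //.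
      by move=> a s1 _ [[[_ ? _ _] _ _ _ _] ? _].
    move=> a s1 aW [J1 A1 X1]; have [H1 V1 F1 P1 C1] := J1.
    have [[_ inp] W1' _ _] := H1.
    apply: runs_loop_free => //; set s2 := run_loop_free _ _.
    have Es2 : s2 = if (a <= xs k)%N then State (upd (imem s1) iC k a) (vmem s1)
                    else s1.
      rewrite /s2 /= A1 P1 W1' (inp _ kN).2 wk divfK ?ler_nat //.
      by rewrite pnatr_eq0 /D; lia.
    rewrite Es2; case: leqP => ax.
      split; first exact: A1.
      split; [|exact: upd_same|].
        split; [exact: H1|exact: V1|exact: F1|exact: P1|] => j jk.
        by rewrite /= upd_array // upd_addr ?ltn_eqF //; exact: C1.
      by move=> _; rewrite /= upd_array // upd_same; lia.
    split; first exact: A1.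
    split; [exact: J1|exact: upd_same|] => _.
    by rewrite /= upd_array // X1; lia.
  move=> s1 [[H1 V1 F1 P1 C1] _ X1].
  have {}X1 : imem s1 iC k = xs k by rewrite X1; lia.
  have [[[_ _ _ y1] inp] W1' B1 _] := H1.
  apply: runs_loop_free => //; set s2 := run_loop_free _ _.
  have Es2 : s2 = State (upd (imem s1) iC k (c k)) (vmem s1).
    rewrite /s2 /= P1 W1' B1 X1 (inp _ kN).1 y1 -eqn_leq /c -/D.
    by case: eqP.
  rewrite Es2; split; first exact: P1.
  split; [exact: H1|exact: V1|exact: F1|exact: upd_same|] => j.
  rewrite ltnS leq_eqVlt => /orP[/eqP ->|jk].
    by rewrite /= upd_array // upd_same.
  by rewrite /= upd_array // upd_addr ?ltn_eqF //; exact: C1.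
- by nia.
- by move=> s' [].
Qed.

Lemma runs_setup s : has_input s ->
  runs setup s (800 * (L * N)) ready.
Proof.
move=> H; rewrite /setup.
apply: (@runs_weaken _ _ ((30 * b + 30) + ((30 * K + 30) + ((30 * K + 30)
  + (300 * L + ((60 * (N + K) + 60) + (100 * (W * N) + 100)))))) _ ready) => //.
  apply/runs_seq/(runs_weaken (runs_compute_W H)) => // s1 [H1 W1].
  apply/runs_seq/(runs_weaken (runs_compute_B H1 W1)) => // s2 [H2 W2 B2].
  apply/runs_seq/(runs_weaken (runs_compute_L H2 W2 B2)) => // s3 H3.
  apply/runs_seq/(runs_weaken (runs_compute_votes H3)) => // s4 [H4 V4].
  apply/runs_seq/(runs_weaken (runs_compute_factorials H4 V4)) => // s5 [H5 V5 F5].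
  exact: runs_compute_keys.
(* All phases fit into [L * N]: [b < W], and [K * W <= L] covers the loops over [K] and over [W]. *)
have := W_gt1; have : (b < W)%N by exact: ltn_expl.
have : (K * W <= L)%N by rewrite /L /B; nia.
have : (L <= L * N)%N by rewrite leq_pmulr.
move: L W => l w0; nia.
Qed.

Lemma encoded_key_bounds j : (j < N)%N -> (B <= c j <= B + 2 * D)%N.
Proof.
move=> jN; have [_ xW] := xsP jN; have := W_gt1.
by rewrite /encoded_key /D; case: ifP; lia.
Qed.

Lemma key_range_lt : (2 * D * K < B)%N.
Proof. by have := W_gt1; rewrite /D /B; nia. Qed.

(** Keys stay below [2 * B] because [2 * D <= 2 * D * K < B]; the vote table therefore covers every
    lookup. *)
Lemma encoded_key_lt a j : (a < L)%N -> (j < N)%N -> (a + c j < L + (B + B))%N.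
Proof.
move=> aL jN; have /andP[_ cj] := encoded_key_bounds jN.
by have := key_range_lt; move: L aL => l al; nia.
Qed.

(** * The loops over players, points and table entries *)

Definition player_context (i : nat) (s : state) : Prop :=
  [/\ ready s, imem s iI 0 = i
    & forall i', (i' < i)%N -> vmem s vout i' = dp_value c N K B D i'].

Definition point_context (i p : nat) (r : rat) (s : state) : Prop :=
  [/\ player_context i s, imem s iP 0 = p,
      forall a, (a < L)%N -> vmem s vF a = knapsack c i p a & vmem s vout i = r].

Lemma add_out_context i p r e s :
  point_context i p r s ->
  point_context i p (r + veval s e) (run_loop_free (add_out e) s).
Proof.
move=> [[Rs Is outs] Ps Fs rs].
split; [split; [exact: Rs|exact: Is|]|exact: Ps|exact: Fs|].
  by move=> i' ii'; rewrite /= Is upd_addr ?ltn_eqF //; exact: outs.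
by rewrite /= Is upd_same rs.
Qed.

Lemma runs_tail_loop i p r s : (i < N)%N -> (p < N)%N ->
  point_context i p r s ->
  runs tail_loop s (150 * L)
    (point_context i p (r + \sum_(0 <= a < L) tail_term c K B D i p a)).
Proof.
move=> iN pN Hs.
pose I n s' := point_context i p (r + \sum_(0 <= a < n) tail_term c K B D i p a) s'
               /\ imem s' iA 0 = n.
apply: (@runs_weaken _ _ ((2 + 11 + 100) * L + 2 + 8) _ (I L)).
- apply: runs_for.
  + by split=> //; rewrite big_geq // addr0; exact: Hs.
  + by move=> n s' _ [[[[[_ _ _ ?] _ _ _] _ _] _ _ _] ?].
  move=> n s' nL [Hs' A']; set e := VMul (VMul _ _) _.
  have [[Rs Is _] Ps Fs _] := Hs'; have [[[[_ K' _ _] _] _ _ _] Vs Ws Cs] := Rs.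
  have Vn a : (a < L)%N -> imem s' iQ a = (a %/ B)%N.
    by move=> aL; apply: (Vs _ _).1; lia.
  have Vk a j : (a < L)%N -> (j < N)%N ->
      vmem s' vV (a + c j)%N = key_vote B D (a + c j)%N.
    by move=> aL jN; apply: (Vs _ _).2; apply: encoded_key_lt.
  (* The factorials read are those of [K], [p - K] and [p + 1], all within the stored range;
     [coalition_weight] truncates [p - K] as the program does. *)
  have De : (K.-1 <= n %/ B)%N -> veval s' e = tail_term c K B D i p n.
    rewrite /tail_term => ->.
    rewrite /= A' Is Ps K' !Cs // !Vk // Fs // !Ws; try lia.
    by rewrite /coalition_weight /= addn1.
  have Hadd := add_out_context e Hs'.
  apply: runs_loop_free => //.
  have -> (e' : vexp) : run_loop_free
      (If (ILe (ISub (cell iK) (INum 1)) (IGet iQ (cell iA))) (add_out e') Skip) s' =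
      if (K.-1 <= n %/ B)%N then run_loop_free (add_out e') s' else s'.
    by rewrite /= A' K' Vn // subn1.
  case: leqP => Kn.
    split; first exact: A'.
    split; last exact: upd_same.
    rewrite big_nat_recr //= addrA -(De Kn); exact: Hadd.
  split; first exact: A'.
  split; last exact: upd_same.
  by rewrite big_nat_recr //= {2}/tail_term leqNgt Kn /= addr0; exact: Hs'.
- by have := L_gt0; move: L => l; lia.
- by move=> s' [].
Qed.

Lemma runs_knapsack_loop i p r s : (p < N)%N -> p != i ->
  point_context i p r s ->
  runs knapsack_loop s (100 * L)
    (fun s' => [/\ player_context i s', imem s' iP 0 = p,
      forall a, (a < L)%N -> vmem s' vF a = knapsack c i p.+1 a
      & vmem s' vout i = r]).
Proof.
move=> pN pi Hs.
(* Addresses from [L - n] up hold the new row. The next pass reads only at or below [L - 1 - n],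
   where the old row survives. *)
pose I n s' := [/\ player_context i s', imem s' iP 0 = p,
  forall a, (a < L)%N ->
    vmem s' vF a = if (a < L - n)%N then knapsack c i p a else knapsack c i p.+1 a,
  vmem s' vout i = r & imem s' iA 0 = n].
have [H P F O] := Hs.
apply: (@runs_weaken _ _ ((2 + 11 + 70) * L + 2 + 8) _ (I L)).
- apply: runs_for.
  + by split=> // a aL; rewrite subn0 aL; exact: F.
  + by move=> n s' _ [[[[_ _ _ ?] _ _ _] _ _] _ _ _ ?].
  move=> n s' nL [H' P' F' O' A']; apply: runs_loop_free => //.
  have [Rs Is outs] := H'; have [[_ _ _ L'] _ _ Cs] := Rs.
  rewrite [run_loop_free _ _]/= A' P' L' Cs //.
  set m := (L - 1 - n)%N.
  have mL : (m < L)%N by rewrite /m; lia.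
  have Lm : (L - n = m.+1)%N by rewrite /m; lia.
  have Lm' : (L - n.+1 = m)%N by rewrite /m; lia.
  case: leqP => cm.
    split; first exact: A'.
    split; [exact: H'|exact: P'| |exact: O'|exact: upd_same] => a aL.
    rewrite Lm'; case: (eqVneq a m) => [->|am].
      rewrite /= upd_same ltnn pi cm !F' // ?Lm ?ltnSn //; last by lia.
      by rewrite ltnS leq_subr.
    rewrite [vmem _ _ _]/= upd_addr // F' // Lm ltnS leq_eqVlt.
    by rewrite (negbTE am).
  split; first exact: A'.
  split; [exact: H'|exact: P'| |exact: O'|exact: upd_same] => a aL.
  rewrite [vmem _ _ _]/= F' // Lm Lm' ltnS leq_eqVlt.
  case: (eqVneq a m) => [->|//] /=.
  by rewrite ltnn leqNgt cm andbF addr0.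
- by have := L_gt0; move: L => l; lia.
- by move=> s' [? ? F' ? _]; split=> // a aL; rewrite F' // subnn.
Qed.

Lemma runs_point_step i p s : (i < N)%N -> (p < N)%N ->
  point_context i p (tail_sum c K B D i p) s ->
  runs point_step s (300 * L)
    (fun s' => imem s' iP 0 = p /\
       point_context i p.+1 (tail_sum c K B D i p.+1) (set_counter iP p.+1 s')).
Proof.
move=> iN pN Hs; have L0 := L_gt0.
apply: (@runs_weaken _ _ ((6 + 150 * L).+1 + (12 + 100 * L).+1) _ (fun s' =>
       imem s' iP 0 = p /\
       point_context i p.+1 (tail_sum c K B D i p.+1) (set_counter iP p.+1 s'))) => //;
  last by move: L L0 => l; lia.
apply: runs_seq; apply: runs_if; rewrite [beval _ _]/=.
have [[Rs Is _] Ps _ _] := Hs; rewrite Is Ps -ltnNge.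
apply: (@runs_weaken _ _ (150 * L) _ (point_context i p (tail_sum c K B D i p.+1))) => //.
  rewrite /tail_sum big_nat_recr //=; case: ltnP => ip.
    exact: runs_tail_loop.
  by apply: runs_loop_free => //; [rewrite muln_gt0 L0|rewrite addr0].
move=> s1 H1; apply: runs_if; rewrite [beval _ _]/=.
have [[R1 I1 O1] P1 F1 r1] := H1; rewrite I1 P1 -eqn_leq.
case: eqVneq => [pi|pi] /=.
  apply: runs_loop_free => //; first by rewrite muln_gt0 L0.
  split; first exact: P1.
  split; [by split|exact: upd_same| |exact: r1] => a aL.
  by rewrite /= F1 // pi eqxx addr0.
apply: (runs_weaken (runs_knapsack_loop pN pi H1)) => // s2 [H2 P2 F2 r2].
split; first exact: P2.
by split; [exact: H2|exact: upd_same|exact: F2|exact: r2].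
Qed.

Lemma runs_small_loop i r s : (i < N)%N ->
  point_context i N r s ->
  runs small_loop s (150 * L)
    (point_context i N (r + \sum_(0 <= a < L) small_term c N B D i a)).
Proof.
move=> iN Hs.
pose I n s' := point_context i N (r + \sum_(0 <= a < n) small_term c N B D i a) s'
               /\ imem s' iA 0 = n.
apply: (@runs_weaken _ _ ((2 + 11 + 100) * L + 2 + 8) _ (I L)).
- apply: runs_for.
  + by split=> //; rewrite big_geq // addr0; exact: Hs.
  + by move=> n s' _ [[[[[_ _ _ ?] _ _ _] _ _] _ _ _] ?].
  move=> n s' nL [Hs' A']; set e := VMul (VMul _ _) _; apply: runs_loop_free => //.
  have [[Rs Is _] Ps Fs _] := Hs'; have [[[[N' _ _ _] _] _ _ _] Vs Ws Cs] := Rs.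
  split; first exact: A'.
  split; last exact: upd_same.
  rewrite big_nat_recr //= addrA.
  (* The size [n %/ B] is below [K], so its factorial is among those stored. *)
  have nQ : (n %/ B < K)%N by rewrite ltn_divLR ?B_gt0.
  have [Qn Vn] : imem s' iQ n = (n %/ B)%N /\ vmem s' vV n = key_vote B D n.
    by apply: Vs; lia.
  have <- : veval s' e = small_term c N B D i n.
    rewrite /= A' Is N' Cs // Qn Vn (Vs _ _).2 ?encoded_key_lt // Fs // !Ws; try lia.
    by rewrite /small_term /coalition_weight subn1.
  exact: (add_out_context e Hs').
- by have := L_gt0; move: L => l; lia.
- by move=> s' [].
Qed.

Lemma runs_player_step i s : (i < N)%N ->
  player_context i s ->
  runs player_step s (800 * (L * N))
    (fun s' => imem s' iI 0 = i /\ player_context i.+1 (set_counter iI i.+1 s')).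
Proof.
move=> iN Hs; have L0 := L_gt0.
pose Q s' := imem s' iI 0 = i /\ player_context i.+1 (set_counter iI i.+1 s').
apply: (@runs_weaken _ _ (((2 + 11 + 5) * L + 2 + 8) + (10 +
   (((2 + 11 + 300 * L) * N + 2 + 8) + 150 * L))) _ Q) => //; last first.
  (* The [N] passes over the [L] entries dominate. *)
  have : (N <= L * N)%N by rewrite leq_pmull.
  have : (L <= L * N)%N by rewrite leq_pmulr.
  by move: L L0 => l; nia.
apply: runs_seq.
pose Z n s' := [/\ player_context i s', imem s' iA 0 = n
                 & forall a, (a < n)%N -> vmem s' vF a = 0].
apply: (@runs_weaken _ _ ((2 + 11 + 5) * L + 2 + 8) _ (Z L)) => //.
  apply: runs_for => //.
    by move=> n s' _ [[[[_ _ _ ?] _ _ _] _ _] ? _].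
  move=> n s' nL [H' A' Z']; apply: runs_loop_free => //=; split; first exact: A'.
  split; [exact: H'|exact: upd_same|] => a; rewrite ltnS leq_eqVlt A'.
  case/orP => [/eqP ->|an]; first by rewrite /= upd_same.
  by rewrite /= upd_addr ?ltn_eqF // Z'.
move=> s1 [[R1 I1 O1] A1 Z1]; apply: runs_seq; apply: runs_loop_free => //.
set s2 := run_loop_free _ _.
(* A cleared table with 1 at address 0 is the row for no points: only the empty set, of key 0. *)
have H2 : point_context i 0 (tail_sum c K B D i 0) (set_counter iP 0 s2).
  rewrite /s2 /tail_sum big_geq //.
  split; [split; [exact: R1|exact: I1|]|exact: upd_same| |].
  - by move=> i' ii'; rewrite /= I1 upd_addr ?ltn_eqF //; exact: O1.
  - move=> a aL; rewrite /= upd_array //.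
    case: (eqVneq a 0%N) => [->|a0]; first by rewrite upd_same.
    by rewrite upd_addr // Z1 //.
  - by rewrite /= I1 upd_same.
apply: runs_seq.
pose J p s' := point_context i p (tail_sum c K B D i p) s'.
apply: (@runs_weaken _ _ ((2 + 11 + 300 * L) * N + 2 + 8) _ (J N)) => //.
  apply: runs_for => //.
    by move=> p s' _ [[[[[[? _ _ _] _] _ _ _] _ _ _] _ _] ? _ _].
  by move=> p s' pN Hs'; apply: runs_point_step.
move=> s3 H3; apply: (runs_weaken (runs_small_loop iN H3)) => //.
move=> s4 [[R4 I4 O4] _ _ r4]; split; first exact: I4.
split; [exact: R4|exact: upd_same|] => i'; rewrite ltnS leq_eqVlt.
case/orP => [/eqP ->|ii']; [exact: r4|exact: O4].
Qed.

Lemma runs_shapley_program s : has_input s ->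
  runs shapley_program s (2000 * (L * N ^ 2))
    (fun s' => forall i, (i < N)%N -> vmem s' vout i = dp_value c N K B D i).
Proof.
move=> H.
apply: (@runs_weaken _ _ (800 * (L * N) + ((2 + 11 + 800 * (L * N)) * N + 2 + 8)) _
          (player_context N)).
- apply/runs_seq/(runs_weaken (runs_setup H)) => // s1 R1; apply: runs_for.
  + by split; [exact: R1|exact: upd_same|].
  + by move=> n s' _ [[[[[? _ _ _] _] _ _ _] _ _ _] ? _].
  + by move=> i s' iN Hs'; apply: runs_player_step.
- have := L_gt0; move: L => l l0; rewrite -mulnn.
  have : (N <= l * (N * N))%N by nia.
  have : (l * N <= l * (N * N))%N by nia.
  by nia.
- by move=> s' [].
Qed.

End Correctness.

Theorem theorem6 :
  exists (P : cmd) (C : nat),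
    forall (R : realFieldType) (X : Type) (d : X -> X -> R)
           (N K b : nat) (z : 'I_N -> X * bool) (zval : X * bool)
           (w : 'I_N -> rat),
      (0 < N)%N -> (2 <= K)%N -> (0 < b)%N ->
      (forall i j : 'I_N, (i <= j)%N -> d (z i).1 zval.1 <= d (z j).1 zval.1) ->
      (forall j : 'I_N, w j \in weight_grid b) ->
      exists (t : nat) (s : state),
        exec P (input_state K b z zval w) t s /\
        (t <= C * (2 ^ b * K ^ 2 * N ^ 2))%N /\
        (forall i : 'I_N, output s i = shapley K z zval w i).
Proof.
(* Since [L] is [2 * W * K ^ 2], the program bound [2000 * (L * N ^ 2)] gives 4000. *)
exists shapley_program, 4000%N => R X d N K b z zval w N0 K2 b0 _ wgrid.
have K0 : (0 < K)%N by apply: leq_trans K2.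
pose lab := array_of 0%N (fun i => (z i).2 : nat).
pose ww := array_of 0 w.
(* The grid has [j / (2 ^ b - 1)] at position [j], so a position is a numerator. *)
pose xs k := index (ww k) (weight_grid b).
have arr (T : Type) (x0 : T) (f : 'I_N -> T) (j : 'I_N) : array_of x0 f j = f j.
  by rewrite /array_of valK.
have xsP j : (j < N)%N ->
    ww j = (xs j)%:R / (2 ^ b - 1)%:R /\ (xs j < 2 ^ b)%N.
  move=> jN; have wj : ww j \in weight_grid b.
    by rewrite -[j]/(val (Ordinal jN)) /ww arr.
  have lt : (xs j < 2 ^ b)%N by rewrite -(size_weight_grid b) index_mem.
  split=> //; rewrite -{1}(nth_index 0 wj) -/(xs j).
  by rewrite (nth_map 0%N) ?size_iota // nth_iota.
have inp : has_input N K b zval.2 lab ww (input_state K b z zval w) by [].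
have [t [s [E tT out]]] := runs_shapley_program N0 K0 b0 xsP inp.
exists t, s; split=> //; split.
  apply: leq_trans tT _; rewrite !expnS expn0; lia.
move=> i; rewrite /output out //; apply: esym; apply: shapley_dp => //.
- by rewrite subn_gt0 -{1}(expn0 2) ltn_exp2l.
- exact: (key_range_lt N0 K0 b0).
- by move=> j; apply: (encoded_key_bounds _ _ N0 K0 b0 xsP).
move=> j.
have [wj xj] := xsP j (ltn_ord j).
have nz : (2 ^ b - 1)%:R != 0 :> rat.
  by rewrite pnatr_eq0 subn_eq0 -ltnNge -{1}(expn0 2) ltn_exp2l.
rewrite /signed_weight /encoded_key /lab arr.
have -> : (nat_of_bool (z j).2 == nat_of_bool zval.2) = ((z j).2 == zval.2).
  by case: (z j).2; case: zval.2.
move: wj; rewrite /ww arr => ->.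
case: eqP => _; first by rewrite natrD addrC addKr.
(* The truncated subtraction passes to the rationals because [xs j <= 2 ^ b - 1]. *)
rewrite [(_ - xs j)%:R]natrB; last by lia.
by rewrite addrAC subrr add0r mulNr.
Qed.
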